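(* Let $X$ be a set. Every right order on the free monoid over $X$ extends to a right order on the free group over $X$.
   Context: A right order on a monoid or group $\mathbf{M}$ is a total order $\le$ on its universe $M$ such that $a\le b$ implies $ac\le bc$ for all $a,b,c\in M$. The free monoid over $X$ is regarded as a submonoid of the free group over $X$ in the natural way, and a right order on the free group extends one on the free monoid if its restriction to the free monoid is the given order. *)

(* Defs.v *)
From HB Require Import structures.
From mathcomp Require Import all_boot.
From mathcomp Require Import boolp.

Set Implicit Arguments.
Unset Strict Implicit.
Unset Printing Implicit Defensive.

Import Algebra.

Local Open Scope group_scope.

(* Only compatibility with multiplication on the right is required. *)
Definition right_order (M : monoidType) (le : rel M) : Prop :=
  [/\ reflexive le, antisymmetric le, transitive le, total le &
      forall a b c : M, le a b -> le (a * c) (b * c)].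

(* The set of generators is an arbitrary type X; {classic X} is X with the
   decidable equality and choice operator given by classical logic. *)
Definition free_monoid (X : Type) : Type := seq {classic X}.

HB.instance Definition _ (X : Type) := Choice.on (free_monoid X).
HB.instance Definition _ (X : Type) :=
  isMonoid.Build (free_monoid X) (@catA {classic X}) (@cat0s _) (@cats0 _).

(* (x, true) stands for x and (x, false) for x^-1. *)
Definition letter (X : Type) : Type := ({classic X} * bool)%type.

HB.instance Definition _ (X : Type) := Choice.on (letter X).

Section ReducedWords.

Variable X : Type.
Implicit Types (l : letter X) (u v w : seq (letter X)).

Definition letter_inv l : letter X := (l.1, ~~ l.2).

Lemma letter_invK : involutive letter_inv.
Proof. by case=> x b; rewrite /letter_inv negbK. Qed.

Definition reduced w : bool := sorted (fun l l' => l' != letter_inv l) w.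

Definition red_cons l w : seq (letter X) :=
  if w is l' :: w' then if l' == letter_inv l then w' else l :: w else [:: l].

Definition red_mul u v : seq (letter X) := foldr red_cons v u.

Definition red_inv u : seq (letter X) := rev (map letter_inv u).

Lemma reduced_behead l w : reduced (l :: w) -> reduced w.
Proof. exact: path_sorted. Qed.

Lemma reduced_red_cons l w : reduced w -> reduced (red_cons l w).
Proof.
case: w => [|l' w] //= rw; case: eqP => [_|/eqP ne]; first exact: path_sorted rw.
by rewrite /reduced /= ne.
Qed.

Lemma reduced_red_mul u v : reduced v -> reduced (red_mul u v).
Proof. by move=> rv; elim: u => //= l u; apply: reduced_red_cons. Qed.

Lemma red_cons_reduced l w : reduced (l :: w) -> red_cons l w = l :: w.
Proof. by case: w => //= l' w /andP[/negPf-> _]. Qed.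

Lemma red_consK l w :
  reduced w -> red_cons (letter_inv l) (red_cons l w) = w.
Proof.
case: w => [|l' w] rw; first by rewrite /= letter_invK eqxx.
rewrite /=; case: eqP => [e|_]; last by rewrite /= letter_invK eqxx.
by rewrite -e red_cons_reduced.
Qed.

Lemma red_mul_cons l u w :
  reduced w -> red_mul (red_cons l u) w = red_cons l (red_mul u w).
Proof.
move=> rw; case: u => [|l' u] //=; case: eqP => [->|//].
by have := red_consK (letter_inv l) (reduced_red_mul u rw); rewrite letter_invK.
Qed.

Lemma red_mulA u v w :
  reduced w -> red_mul u (red_mul v w) = red_mul (red_mul u v) w.
Proof. by move=> rw; elim: u => //= l u ->; rewrite red_mul_cons. Qed.

Lemma red_mul0 u : reduced u -> red_mul u [::] = u.
Proof.
elim: u => //= l u IHu ru.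
by rewrite IHu ?(reduced_behead ru) // red_cons_reduced.
Qed.

Lemma reduced_red_inv u : reduced u -> reduced (red_inv u).
Proof.
rewrite /reduced /red_inv rev_sorted sorted_map.
by apply: sub_sorted => l l' /=; rewrite letter_invK eq_sym.
Qed.

Lemma red_invK u : red_inv (red_inv u) = u.
Proof.
by rewrite /red_inv map_rev revK -map_comp map_id_in // => l _ /=;
  rewrite letter_invK.
Qed.

Lemma red_mulVw u : red_mul (red_inv u) u = [::].
Proof.
elim: u => //= l u IHu.
by rewrite /red_inv /= rev_cons /red_mul foldr_rcons /= letter_invK eqxx.
Qed.

End ReducedWords.

Record free_group (X : Type) : Type :=
  FreeGroup { word :> seq (letter X); _ : reduced word }.

HB.instance Definition _ (X : Type) := [isSub for @word X].
HB.instance Definition _ (X : Type) := [Choice of free_group X by <:].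

Section FreeGroup.

Variable X : Type.
Implicit Types u v w : free_group X.

Definition fg_one : free_group X := @FreeGroup X [::] isT.
Definition fg_mul u v : free_group X :=
  FreeGroup (reduced_red_mul (word u) (valP v)).
Definition fg_inv u : free_group X := FreeGroup (reduced_red_inv (valP u)).

Lemma fg_mulA : associative fg_mul.
Proof. by move=> u v w; apply/val_inj/red_mulA/(valP w). Qed.

Lemma fg_mul1g : left_id fg_one fg_mul.
Proof. by move=> u; apply/val_inj. Qed.

Lemma fg_mulg1 : right_id fg_one fg_mul.
Proof. by move=> u; apply/val_inj/red_mul0/(valP u). Qed.

Lemma fg_mulVg : left_inverse fg_one fg_inv fg_mul.
Proof. by move=> u; apply/val_inj/red_mulVw. Qed.

Lemma fg_mulgV : right_inverse fg_one fg_inv fg_mul.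
Proof.
by move=> u; apply/val_inj; rewrite /= -{1}[word u]red_invK red_mulVw.
Qed.

HB.instance Definition _ := isGroup.Build (free_group X)
  fg_mulA fg_mul1g fg_mulg1 fg_mulVg fg_mulgV.

Definition free_group_gen (x : X) : free_group X :=
  @FreeGroup X [:: (x, true)] isT.

Lemma reduced_positive (s : free_monoid X) :
  reduced [seq (x, true) : letter X | x <- s].
Proof.
rewrite /reduced sorted_map; case: s => //= x s.
by elim: s x => //= y s IHs x; rewrite IHs andbT xpair_eqE andbF.
Qed.

Definition free_monoid_embed (s : free_monoid X) : free_group X :=
  FreeGroup (reduced_positive s).

Lemma free_monoid_embed_inj : injective free_monoid_embed.
Proof. by move=> s t /(congr1 val) /= /inj_map; apply=> x y []. Qed.

Lemma free_monoid_embed_morphism : monoid_morphism free_monoid_embed.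
Proof.
split=> [|s t]; apply/val_inj => //=.
elim: s => //= x s <-; rewrite red_cons_reduced //.
exact: (reduced_positive (x :: (s ++ t))).
Qed.

Lemma free_monoid_embed_gen (x : X) :
  free_monoid_embed [:: x : {classic X}] = free_group_gen x.
Proof. exact: val_inj. Qed.

Lemma free_group_universal (G : groupType) (f : X -> G) :
  exists! phi : free_group X -> G,
    monoid_morphism phi /\ forall x, phi (free_group_gen x) = f x.
Proof.
pose val1 (l : letter X) : G := if l.2 then f l.1 else (f l.1)^-1.
pose ev (s : seq (letter X)) : G := foldr (fun l g => val1 l * g) 1 s.
have val1V l : val1 l * val1 (letter_inv l) = 1.
  by rewrite /val1; case: l => x [] /=; rewrite (mulgV, mulVg).
have ev_cons l s : ev (red_cons l s) = val1 l * ev s.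
  by case: s => //= l' s; case: eqP => //= ->; rewrite mulgA val1V mul1g.
exists (fun u => ev (word u)); split.
  split=> [|x]; last exact: mulg1.
  split=> // u v /=; elim: (word u) => /= [|l s IHs]; first by rewrite mul1g.
  by rewrite ev_cons IHs mulgA.
move=> psi [[psi1 psiM] psi_gen]; apply/funext => -[s rs] /=.
have psi_letter (l : letter X) (rl : reduced [:: l]) : psi (FreeGroup rl) = val1 l.
  case: l rl => x [] rl; rewrite /val1 /= -psi_gen.
    by congr psi; apply: val_inj.
  set g := psi (FreeGroup rl).
  rewrite -[LHS]mul1g -(mulVg (psi (free_group_gen x))) -mulgA -psiM.
  have -> : free_group_gen x * FreeGroup rl = 1 by apply: val_inj; rewrite /= eqxx.
  by rewrite psi1 mulg1.
elim: s rs => [|l s IHs] rs /=.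
  by rewrite -psi1; congr psi; apply: val_inj.
rewrite (IHs (reduced_behead rs)) -(psi_letter l isT) -psiM.
by congr psi; apply: val_inj; rewrite /= red_cons_reduced.
Qed.

End FreeGroup.

(* Main.v *)
Require Import Defs.
From mathcomp Require Import all_boot.
From mathcomp Require Import boolp classical_sets.

Set Implicit Arguments.
Unset Strict Implicit.
Unset Printing Implicit Defensive.

Local Open Scope classical_set_scope.

(** The map g |-> g^-1 turns right orders on the free group F into left orders,
    and left multiplication by a letter l is [red_cons l], so it is a left order
    on reduced words that is built here. In the Cayley graph of F, a tree whose
    edges join u and l * u, the inverses of the positive words form a subtree,
    and the given right order on the monoid orders it in such a way that each
    letter acts as an order-preserving partial map. Such partial left orders, on
    subtrees given by suffix-closed sets of reduced words, can be enlarged one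
    vertex at a time: a new vertex l * u, adjacent to the old vertex u, has no
    other old neighbour because the graph is a tree. The only condition on its
    position is therefore that it lie above every old l * t with t < u and below
    every old l * t with u < t. As l preserves the order, the downward closure
    of the former points contains none of the latter, and the new vertex can be
    put just above it ([partial_left_order_insert_leaf]). A maximal partial left
    order given by Zorn's lemma is thus defined on all of F, and it is invariant
    under all letters, hence under F. *)

(** * Partial left orders on subtrees *)

Section PartialLeftOrders.

Variable X : Type.
Implicit Types (l m : letter X) (a b t u v w : seq (letter X)).
Implicit Types (A B : set (seq (letter X) * seq (letter X))).

(** As the orders are reflexive, the underlying set of words need not be part
    of the data, and enlarging an order is plain inclusion. *)
Definition dom A u : Prop := A (u, u).

Record partial_left_order A : Prop := PartialLeftOrder {
  plo_dom : forall u v, A (u, v) -> dom A u /\ dom A v;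
  plo_reduced : forall u, dom A u -> reduced u;
  plo_behead : forall l u, dom A (l :: u) -> dom A u;
  plo_anti : forall u v, A (u, v) -> A (v, u) -> u = v;
  plo_trans : forall u v w, A (u, v) -> A (v, w) -> A (u, w);
  plo_total : forall u v, dom A u -> dom A v -> A (u, v) \/ A (v, u);
  plo_cons : forall l u v, A (u, v) ->
    dom A (red_cons l u) -> dom A (red_cons l v) ->
    A (red_cons l u, red_cons l v) }.

Lemma letter_inv_neq l : letter_inv l <> l.
Proof. by case: l => x []. Qed.

Lemma red_consVK l w :
  reduced w -> red_cons l (red_cons (letter_inv l) w) = w.
Proof. by move=> rw; rewrite -{1}[l]letter_invK red_consK. Qed.

(** This is where the Cayley graph being a tree is used: no extension of a word
    outside a suffix-closed set lies in that set, so multiplication by a letter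
    can enter the set only by cancelling the head. *)
Lemma outer_vertex A m w : partial_left_order A ->
  ~ dom A w -> dom A (red_cons m w) -> w = letter_inv m :: red_cons m w.
Proof.
move=> pA; case: w => [|l w] /= nw; first by move/(plo_behead pA).
by case: eqP => [->|_] // /(plo_behead pA).
Qed.

(** * Extension by one vertex *)

Definition insert_at A (L : seq (letter X) -> Prop) w : set (_ * _) :=
  [set p | [\/ A p, p = (w, w),
               [/\ dom A p.1, p.2 = w & L p.1] |
               [/\ p.1 = w, dom A p.2 & ~ L p.2]]].

Section InsertLeaf.

Variables (A : set (seq (letter X) * seq (letter X))) (l : letter X).
Variable u : seq (letter X).
Hypotheses (pA : partial_left_order A) (Au : dom A u).
Hypotheses (rlu : reduced (l :: u)) (nlu : ~ dom A (l :: u)).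

(** The old points that go below the new vertex. The point t is automatically
    different from u, since l * u is new. *)
Definition leaf_cut a : Prop :=
  exists t, [/\ A (t, u), dom A (red_cons l t) & A (a, red_cons l t)].

Let A' := insert_at A leaf_cut (l :: u).

Let cut_down a b : A (a, b) -> leaf_cut b -> leaf_cut a.
Proof.
by move=> Aab [t [Atu Alt Abt]]; exists t; split=> //; apply: plo_trans Abt.
Qed.

Let dom'P a : dom A' a <-> dom A a \/ a = l :: u.
Proof.
split; last by case=> [Aa|->]; [apply: Or41|apply: Or42].
by case=> [|[->]|[]|[]]; [left|right|right|right].
Qed.

(* The only edge between the new vertex and the old ones joins it to [u]: it is
   traversed by [l] from [u] and by the inverse of [l] towards [u]. *)
Let to_leaf m a : dom A a -> red_cons m a = l :: u -> m = l /\ a = u.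
Proof.
move=> Aa e; have ra := plo_reduced pA Aa.
have e' : a = red_cons (letter_inv m) (l :: u) by rewrite -e red_consK.
have := @outer_vertex _ (letter_inv m) _ pA nlu.
by rewrite -e' letter_invK => /(_ Aa) [-> ->].
Qed.

Let from_leaf m : dom A' (red_cons m (l :: u)) ->
  m = letter_inv l /\ red_cons m (l :: u) = u.
Proof.
move/dom'P => [d|e].
  have [el eu] := outer_vertex pA nlu d.
  by split; first by rewrite el letter_invK.
move: e => /=; case: eqP => _ /(congr1 size) /= /eqP.
  by rewrite ltn_eqF.
by rewrite gtn_eqF.
Qed.

Let red_consu : red_cons l u = l :: u.
Proof. exact: red_cons_reduced. Qed.

Let insert_leaf_cons m a b : A' (a, b) ->
  dom A' (red_cons m a) -> dom A' (red_cons m b) ->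
  A' (red_cons m a, red_cons m b).
Proof.
case=> /= [Aab|[-> ->]|[Aa -> La]|[-> Ab nLb]] //.
- have [Aa Ab] := plo_dom pA Aab.
  move=> /dom'P[Ama|ea] /dom'P[Amb|eb].
  + by apply: Or41; apply: (plo_cons pA).
  + have [? ?] := to_leaf Ab eb; subst m b.
    by rewrite red_consu; apply: Or43; split=> //; exists a; split.
  + have [? ?] := to_leaf Aa ea; subst m a.
    rewrite red_consu; apply: Or44; split=> // -[t [Atu Alt Abt]].
    have rt := plo_reduced pA (plo_dom pA Atu).1.
    have rb := plo_reduced pA Ab.
    (* [l * b] cannot be in the cut: cancelling [l] would give b <= t <= u,
       hence b = u, but [l * u] is new while [l * b] is old. *)
    have Abt' : A (b, t).
      rewrite -(red_consK l rb) -(red_consK l rt).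
      apply: (plo_cons pA) => //; rewrite red_consK //.
      by case: (plo_dom pA Atu).
    have eub : u = b by apply: (plo_anti pA) => //; apply: (plo_trans pA) Atu.
    by move: Amb; rewrite -eub red_consu.
  + by rewrite ea eb; apply/dom'P; right.
- move=> /dom'P dma /from_leaf[em ->]; subst m.
  case: dma => [Ama|/(to_leaf Aa)[/letter_inv_neq //]].
  have [t [Atu Alt Aat]] := La.
  have rt := plo_reduced pA (plo_dom pA Atu).1.
  apply: Or41; apply: (plo_trans pA _ Atu).
  rewrite -(red_consK l rt); apply: (plo_cons pA) => //.
  by rewrite red_consK //; case: (plo_dom pA Atu).
- move=> /from_leaf[em ->] /dom'P; subst m.
  case=> [Amb|/(to_leaf Ab)[/letter_inv_neq //]].
  apply: Or41; case: (plo_total pA Au Amb) => // Abu; case: nLb.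
  exists (red_cons (letter_inv l) b).
  by rewrite red_consVK //; apply: (plo_reduced pA).
Qed.

(** Being an order holds for any downward closed cut. The choice of the cut
    matters for compatibility with [l] and its inverse on the edge joining [u]
    to the new vertex, and no other product within the enlarged domain
    involves the new vertex. *)
Lemma partial_left_order_insert_leaf : partial_left_order A'.
Proof.
split.
- move=> a b [/(plo_dom pA)[Aa Ab]|[-> ->]|[/= Aa -> _]|[/= -> Ab _]];
    by split; apply/dom'P; tauto.
- by move=> a /dom'P[/(plo_reduced pA)|->].
- by move=> m a /dom'P[/(plo_behead pA) Aa|[_ ->]]; apply/dom'P; left.
- move=> a b [/= Aab|[-> ->]|[/= Aa eb La]|[/= ea Ab nLb]] //.
  + case=> /= [Aba|[-> ->]|[Ab ea Lb]|[eb Aa nLa]] //.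
    * exact: (plo_anti pA).
    * by subst a; case: (nlu (plo_dom pA Aab).1).
    * by subst b; case: (nlu (plo_dom pA Aab).2).
  + subst b; case=> /= [/(plo_dom pA)[] //|[] //|[] //|[_ _ nLa]].
    by case: nLa.
  + subst a; case=> /= [/(plo_dom pA)[] //|[] //|[_ _ Lb]|[_ /nlu //]].
    by case: nLb.
- move=> a b c [/= Aab|[-> ->]|[/= Aa eb La]|[/= ea Ab nLb]] //.
  + case=> /= [Abc|[eb _]|[Ab -> Lb]|[eb _ _]].
    * by apply/Or41/(plo_trans pA)/Abc.
    * by subst b; case: (nlu (plo_dom pA Aab).2).
    * by apply: Or43; split=> //; [case: (plo_dom pA Aab)|apply: cut_down Lb].
    * by subst b; case: (nlu (plo_dom pA Aab).2).
  + subst b; case=> /= [/(plo_dom pA)[] //|[->]|[] //|[_ Ac nLc]].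
      exact: Or43.
    apply: Or41; case: (plo_total pA Aa Ac) => // Aca.
    by case: nLc; apply: cut_down La.
  + subst a; case=> /= [Abc|[eb ->]|[_ _ Lb]|[eb _ _]].
    * apply: Or44; split=> //; first by case: (plo_dom pA Abc).
      by move=> /(cut_down Abc).
    * exact: Or42.
    * by case: nLb.
    * by subst b; case: nlu.
- move=> a b /dom'P[Aa|->] /dom'P[Ab|->].
  + by case: (plo_total pA Aa Ab) => ?; [left|right]; apply: Or41.
  + by case: (EM (leaf_cut a)) => ?; [left; apply: Or43|right; apply: Or44].
  + by case: (EM (leaf_cut b)) => ?; [right; apply: Or43|left; apply: Or44].
  + by left; apply: Or42.
- exact: insert_leaf_cons.
Qed.

End InsertLeaf.

(** * Maximal partial left orders *)

(** The axioms of an order speak of at most three pairs at a time, so this is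
    what makes them pass to unions of chains. *)
Lemma chain_bigcup3 (T : Type) (F : set (set T)) x y z :
  total_on F subset ->
  (\bigcup_(U in F) U) x -> (\bigcup_(U in F) U) y -> (\bigcup_(U in F) U) z ->
  exists U, [/\ F U, U x, U y & U z].
Proof.
move=> Ftot.
have join U V : F U -> F V -> exists W, [/\ F W, U `<=` W & V `<=` W].
  by move=> FU FV; case: (Ftot _ _ FU FV) => UV; [exists V|exists U]; split.
move=> [U FU Ux] [V FV Vy] [W FW Wz].
have [U' [FU' UU' VU']] := join _ _ FU FV.
have [G [FG U'G WG]] := join _ _ FU' FW.
by exists G; split=> //; [apply/U'G/UU'|apply/U'G/VU'|apply: WG].
Qed.

Lemma partial_left_order_bigcup (F : set (set (_ * _))) :
  F `<=` partial_left_order -> total_on F subset ->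
  partial_left_order (\bigcup_(B in F) B).
Proof.
move=> Fplo Ftot; split.
- move=> u v [B FB Buv]; have [Bu Bv] := plo_dom (Fplo _ FB) Buv.
  by split; exists B.
- by move=> u [B /Fplo pB Bu]; apply: (plo_reduced pB).
- by move=> l u [B FB Bu]; exists B => //; apply: (plo_behead (Fplo _ FB)) Bu.
- move=> u v uv vu; have [B [/Fplo pB Buv Bvu _]] := chain_bigcup3 Ftot uv vu vu.
  exact: (plo_anti pB).
- move=> u v w uv vw; have [B [FB Buv Bvw _]] := chain_bigcup3 Ftot uv vw vw.
  by exists B => //; apply: (plo_trans (Fplo _ FB)) Bvw.
- move=> u v uu vv; have [B [FB Bu Bv _]] := chain_bigcup3 Ftot uu vv vv.
  by case: (plo_total (Fplo _ FB) Bu Bv) => ?; [left|right]; exists B.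
- move=> l u v uv lu lv; have [B [FB Buv Blu Blv]] := chain_bigcup3 Ftot uv lu lv.
  by exists B => //; apply: (plo_cons (Fplo _ FB)).
Qed.

(** By induction on the length, a missing reduced word of minimal length hangs
    from a word of the domain, so that a maximal order misses none. The empty
    word starts the induction. *)
Lemma partial_left_order_extension B : partial_left_order B -> dom B [::] ->
  exists A, [/\ partial_left_order A, B `<=` A & forall u, reduced u -> dom A u].
Proof.
move=> pB B1.
(* The union of the empty chain is empty and does not contain [B]: hence the
   guard. *)
pose P A := partial_left_order A /\ (A !=set0 -> B `<=` A).
have [|A [[pA BA] Amax]] := @Zorn_bigcup _ P.
  move=> F FP Ftot; split.
    by apply: partial_left_order_bigcup => // A /FP[].
  move=> [p [A FA Ap]] q Bq; exists A => //.
  by apply: (FP _ FA).2 => //; exists p.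
have {}BA : B `<=` A.
  apply: BA; apply/set0P/eqP => A0; apply: (Amax B); last by split=> // _ p.
  by rewrite A0; split=> // /(_ _ B1).
exists A; split=> //; elim=> [|l u IHu] rlu; first exact: BA.
apply: contrapT => nlu; have Au := IHu (reduced_behead rlu).
apply: (Amax (insert_at A (leaf_cut A l u) (l :: u))).
  split; first by move=> p Ap; apply: Or41.
  by move/(_ (l :: u, l :: u)) => /(_ (Or42 _ _ _ erefl)).
split; first exact: partial_left_order_insert_leaf.
by move=> _ p /BA Ap; apply: Or41.
Qed.

(** * From monoid orders to group orders *)

Definition monoid_inv (s : free_monoid X) : seq (letter X) :=
  red_inv (free_monoid_embed s).

Lemma monoid_inv_rcons (x : {classic X}) (s : free_monoid X) :
  monoid_inv (rcons s x) = (x, false) :: monoid_inv s.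
Proof. by rewrite /monoid_inv /= map_rcons /red_inv map_rcons rev_rcons. Qed.

Lemma monoid_inv_inj : injective monoid_inv.
Proof.
by move=> s t /(can_inj (@red_invK X)) e; apply/free_monoid_embed_inj/val_inj.
Qed.

Lemma reduced_monoid_inv s : reduced (monoid_inv s).
Proof. exact/reduced_red_inv/(valP (free_monoid_embed s)). Qed.

Lemma red_cons_monoid_inv (x : {classic X}) (s : free_monoid X) :
  red_cons (x, false) (monoid_inv s) = monoid_inv (rcons s x).
Proof.
by rewrite monoid_inv_rcons red_cons_reduced // -monoid_inv_rcons
  reduced_monoid_inv.
Qed.

Definition monoid_left_order (le : rel (free_monoid X)) : set (_ * _) :=
  [set p | exists s t : free_monoid X, le s t /\ p = (monoid_inv s, monoid_inv t)].

Lemma monoid_left_orderE (le : rel (free_monoid X)) (s t : free_monoid X) :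
  monoid_left_order le (monoid_inv s, monoid_inv t) <-> le s t.
Proof.
split=> [[s' [t' [le_st [/monoid_inv_inj-> /monoid_inv_inj->]]]]|] //.
by exists s, t.
Qed.

(** A positive letter acts here as the inverse of right multiplication by a
    generator, which reflects the order because the order is total. *)
Lemma partial_left_order_monoid (le : rel (free_monoid X)) :
  right_order le -> partial_left_order (monoid_left_order le).
Proof.
move=> [le_refl le_anti le_trans le_total le_mul].
have le_rcons (x : {classic X}) (s t : free_monoid X) :
    le s t -> le (rcons s x) (rcons t x).
  by rewrite -!cats1; apply: le_mul.
have domE u : dom (monoid_left_order le) u -> exists s, u = monoid_inv s.
  by move=> [s [_ [_ [-> _]]]]; exists s.
have dom_inv s : dom (monoid_left_order le) (monoid_inv s).
  by apply/monoid_left_orderE.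
split.
- by move=> u v [s [t [_ [-> ->]]]].
- by move=> u /domE[s ->]; apply: reduced_monoid_inv.
- move=> l u /domE[s]; case/lastP: s => [//|s x].
  by rewrite monoid_inv_rcons => -[_ ->].
- move=> u v [s [t [st [-> ->]]]] /monoid_left_orderE ts.
  by congr monoid_inv; apply: le_anti; rewrite st.
- move=> u v w [s [t [st [-> ->]]]] [t' [r [tr [/monoid_inv_inj e ->]]]].
  by apply/monoid_left_orderE; apply: le_trans st _; rewrite e.
- move=> u v /domE[s ->] /domE[t ->].
  by case/orP: (le_total s t) => ?; [left|right]; apply/monoid_left_orderE.
- move=> [x []] u v [s [t [st [-> ->]]]]; last first.
    by rewrite !red_cons_monoid_inv => _ _; apply/monoid_left_orderE/le_rcons.
  move=> /domE[s' es] /domE[t' et]; rewrite es et; apply/monoid_left_orderE.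
  have cancel (r r' : free_monoid X) :
      red_cons (x, true) (monoid_inv r) = monoid_inv r' -> r = rcons r' x.
    move=> e; apply: monoid_inv_inj; rewrite -red_cons_monoid_inv -e.
    by rewrite (red_consK (x, true)) ?reduced_monoid_inv.
  move: st; rewrite (cancel _ _ es) (cancel _ _ et) => st.
  case/orP: (le_total s' t') => // /(le_rcons x) ts.
  have /(congr1 rev) : rcons s' x = rcons t' x by apply: le_anti; rewrite st.
  by rewrite !rev_rcons => -[/(can_inj revK)->].
Qed.

Lemma plo_red_mul A w u v : partial_left_order A ->
  (forall t, reduced t -> dom A t) ->
  A (u, v) -> A (red_mul w u, red_mul w v).
Proof.
move=> pA Adom Auv; have [/(plo_reduced pA) ru /(plo_reduced pA) rv] :=
  plo_dom pA Auv.
elim: w => //= l w IHw.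
by apply: (plo_cons pA) => //; apply/Adom/reduced_red_cons/reduced_red_mul.
Qed.

Lemma red_inv_mul (g h : free_group X) :
  red_inv (fg_mul g h) = red_mul (red_inv h) (red_inv g).
Proof. exact: (congr1 (@word X) (invgM g h)). Qed.

End PartialLeftOrders.

Theorem corollary3p4 (X : Type) (le : rel (free_monoid X)) :
  right_order le ->
  exists le' : rel (free_group X),
    right_order le' /\
    forall s t : free_monoid X,
      le' (free_monoid_embed s) (free_monoid_embed t) = le s t.
Proof.
move=> le_ro; have pB := partial_left_order_monoid le_ro.
have [le_refl _ _ le_total _] := le_ro.
have B1 : dom (monoid_left_order le) [::].
  exact/(monoid_left_orderE le [::] [::]).
have [A [pA BA Adom]] := partial_left_order_extension pB B1.
have Ainv (g : free_group X) : dom A (red_inv g).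
  exact/Adom/reduced_red_inv/(valP g).
exists (fun g h => `[< A (red_inv g, red_inv h) >]); split.
  split.
  - by move=> g; apply/asboolP/Ainv.
  - move=> g h /andP[/asboolP gh /asboolP hg].
    by apply: val_inj; apply: (can_inj (@red_invK X)); apply: (plo_anti pA).
  - move=> h g k /asboolP gh /asboolP hk.
    by apply/asboolP; apply: (plo_trans pA) hk.
  - move=> g h; apply/orP.
    by case: (plo_total pA (Ainv g) (Ainv h)) => ?; [left|right]; apply/asboolP.
  - move=> g h k /asboolP gh; apply/asboolP.
    by rewrite /mul /= !red_inv_mul; apply: plo_red_mul.
move=> s t; apply/asboolP/idP => [Ast|st]; last first.
  exact/BA/monoid_left_orderE.
(* On a total order, extension by a larger antisymmetric relation is faithful. *)
case/orP: (le_total s t) => // ts.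
have Ats : A (monoid_inv t, monoid_inv s) by apply/BA/monoid_left_orderE.
by rewrite (monoid_inv_inj (plo_anti pA Ast Ats)).
Qed.
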